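(* Let $(K,d)$ be a nonempty compact metric space and $\Phi$ a closed subspace of $\mathcal{C}(K)$ which separates the points of $K$ and contains the constant functions. Let $\mathcal{B}$ be a $\Phi$-stable subset of $T\mathcal{C}^{>}(K)$. Then the set $$\mathcal{G}:=\{f\in\mathcal{B}:\ K_{\max}(f)\ \text{is a singleton}\}$$ is a dense $G_\delta$ subset of $(\mathcal{B},\rho_\infty)$.
   Context: $\mathcal{C}(K)$ is the Banach space of continuous real-valued functions on $K$ with the sup-norm, and $w^*$ is the weak-star topology of $\Phi^*$. $K(\Phi):=\{Q\in\Phi^*:\ \|Q\|=\langle Q,\mathbf 1\rangle=1\}$ (with $\mathbf 1$ the constant function $1$), a convex $w^*$-compact subset of $\Phi^*$. $\delta^\Phi:K\to K(\Phi)$ is $\delta^\Phi(x)(\phi)=\phi(x)$. $T\mathcal{C}^{>}(K)$ (usc convex-trace functions) is the set of functions $f:K\to\mathbb{R}$ of the form $f=F\circ\delta^\Phi$ with $F:K(\Phi)\to\mathbb{R}$ convex and $w^*$-upper semicontinuous. A set $\mathcal{B}\subset\mathbb{R}^K$ is $\Phi$-stable if $\Phi+\mathcal{B}\subset\mathcal{B}$. For $f:K\to\mathbb{R}$, $K_{\max}(f):=\{\bar x\in K:\ f(\bar x)=\max_{x\in K}f(x)\}$. The metric $\rho_\infty$ on $\mathbb{R}^K$ is $\rho_\infty(f,g):=\sup_{x\in K}\frac{|f(x)-g(x)|}{1+|f(x)-g(x)|}$. *)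

(* Defs.v *)
From HB Require Import structures.
From mathcomp Require Import all_boot all_order all_algebra.
From mathcomp Require Import all_classical all_reals all_analysis.
From mathcomp Require Import borel_hierarchy.

Set Implicit Arguments.
Unset Strict Implicit.
Unset Printing Implicit Defensive.

Import Order.TTheory GRing.Theory Num.Theory.
Import numFieldNormedType.Exports.

Local Open Scope classical_set_scope.
Local Open Scope ring_scope.

Section sup_real.
Context {R : realType}.
Implicit Types (A B : set R).

Lemma le_sup_ub A x b : ubound A b -> A x -> x <= sup A.
Proof. by move=> Ab Ax; apply: ub_le_sup => //; exists b. Qed.

Lemma sup_le_ub0 A b : 0 <= b -> ubound A b -> sup A <= b.
Proof.
move=> b0 Ab; have [->|A0] := eqVneq A set0; first by rewrite sup0.
by apply: ge_sup => //; exact/set0P.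
Qed.

Lemma sup_ge0 A b : ubound A b -> A `<=` [set x | 0 <= x] -> 0 <= sup A.
Proof.
move=> Ab A0; have [->|/set0P[x Ax]] := eqVneq A set0; first by rewrite sup0.
exact: le_trans (A0 _ Ax) (le_sup_ub Ab Ax).
Qed.

End sup_real.

(* The compactness proof is a parameter of the type, so that the sup-norm
   structure can be attached to it. *)
Definition cspace (R : realType) (K : topologicalType)
  (cK : compact [set: K]) : Type := continuousType K R.

Section cspace_lmodule.
Context (R : realType) (K : topologicalType) (cK : compact [set: K]).
Local Notation C := (cspace R cK).

Definition cspace_fun (f : C) : K -> R := @Continuous.sort K R f.
Definition continuous_pred : {pred K -> R} := mem [set f | continuous f].

Definition cspace_Sub (f : K -> R) (fP : f \in continuous_pred) : C :=
  mkcts (set_mem fP).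

Lemma cspace_rect (P : C -> Type) :
  (forall f (fP : f \in continuous_pred), P (cspace_Sub fP)) -> forall u, P u.
Proof.
move=> Psub u.
have uP : cspace_fun u \in continuous_pred by apply/mem_set; exact: cts_fun.
suff <- : cspace_Sub uP = u by exact: Psub.
exact/continuousEP.
Qed.

Lemma cspace_valP f (fP : f \in continuous_pred) :
  cspace_fun (cspace_Sub fP) = f.
Proof. by []. Qed.

HB.instance Definition _ := isSub.Build _ _ C cspace_rect cspace_valP.
HB.instance Definition _ := [Choice of C by <:].

Lemma continuous_submod : submod_closed continuous_pred.
Proof.
split; first by apply/mem_set; move=> x; exact: cvg_cst.
move=> a f g /set_mem cf /set_mem cg; apply/mem_set => x.
by apply: cvgD; [apply: cvgZl_tmp; exact: cf|exact: cg].
Qed.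

HB.instance Definition _ :=
  GRing.isSubmodClosed.Build R _ continuous_pred continuous_submod.
HB.instance Definition _ := [SubChoice_isSubLmodule of C by <:].

End cspace_lmodule.

Coercion cspace_fun : cspace >-> Funclass.

Section cspace_norm.
Context (R : realType) (K : topologicalType) (cK : compact [set: K]).
Local Notation C := (cspace R cK).
Implicit Types f g : C.

Definition supnorm f : R := sup (range (fun x => `|f x|)).

Lemma cspace_ub f : exists b, ubound (range (fun x => `|f x|)) b.
Proof.
have cf : continuous f by exact: cts_fun.
have /compact_bounded[M [_ Mb]] : compact (f @` [set: K]).
  by apply: continuous_compact => //; exact: continuous_subspaceT.
exists (M + 1) => _ [x _ <-].
by apply: (Mb (M + 1)); [rewrite ltrDl|exists x].
Qed.

Lemma le_supnorm f x : `|f x| <= supnorm f.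
Proof. by have [b fb] := cspace_ub f; apply: (le_sup_ub fb); exists x. Qed.

Lemma supnorm_ge0 f : 0 <= supnorm f.
Proof.
by have [b fb] := cspace_ub f; apply: (sup_ge0 fb) => _ [x _ <-] /=.
Qed.

Lemma supnorm_le f b : 0 <= b -> (forall x, `|f x| <= b) -> supnorm f <= b.
Proof. by move=> b0 fb; apply: sup_le_ub0 => // _ [x _ <-]. Qed.

Lemma supnormD f g : supnorm (f + g) <= supnorm f + supnorm g.
Proof.
apply: supnorm_le => [|x]; first by rewrite addr_ge0// supnorm_ge0.
by rewrite (le_trans (ler_normD _ _))// lerD// le_supnorm.
Qed.

Lemma supnormZ a f : supnorm (a *: f) = `|a| * supnorm f.
Proof.
have le b h : supnorm (b *: h) <= `|b| * supnorm h.
  apply: supnorm_le => [|x]; first by rewrite mulr_ge0// supnorm_ge0.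
  by rewrite [leLHS]normrM ler_wpM2l// le_supnorm.
apply/le_anti; rewrite le//=.
have [->|a0] := eqVneq a 0; first by rewrite normr0 mul0r supnorm_ge0.
rewrite -ler_pdivlMl ?normr_gt0// -normfV.
by rewrite -{1}[f](scalerK a0) le.
Qed.

Lemma supnorm_eq0 f : supnorm f = 0 -> f = 0.
Proof.
move=> f0; apply/val_inj/funext => x.
by apply/eqP; rewrite -normr_le0 -f0 le_supnorm.
Qed.

HB.instance Definition _ :=
  Lmodule_isNormed.Build R C supnormD supnormZ supnorm_eq0.

Lemma ccst_subproof (c : R) : continuous (cst c : K -> R).
Proof. by move=> x; exact: cvg_cst. Qed.

Definition ccst (c : R) : C :=
  (mkcts (@ccst_subproof c) : continuousType K R).

End cspace_norm.

Section subspace_norm.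
Context (R : realType) (V : normedModType R) (S : submodClosed V).

Definition subnormed : Type := {v : V | v \in S}.

HB.instance Definition _ := SubChoice.on subnormed.
HB.instance Definition _ := [SubChoice_isSubLmodule of subnormed by <:].

Definition subnorm (u : subnormed) : R := `|val u|.

Lemma subnormD u v : subnorm (u + v) <= subnorm u + subnorm v.
Proof. exact: ler_normD. Qed.

Lemma subnormZ a u : subnorm (a *: u) = `|a| * subnorm u.
Proof. exact: normrZ. Qed.

Lemma subnorm_eq0 u : subnorm u = 0 -> u = 0.
Proof. by move=> /normr0_eq0 u0; exact/val_inj. Qed.

HB.instance Definition _ :=
  Lmodule_isNormed.Build R subnormed subnormD subnormZ subnorm_eq0.

End subspace_norm.

Section dual.
Context (R : realType) (V : normedModType R).

Definition functional_pred : {pred V -> R} :=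
  mem [set Q : V -> R | linear (Q : V -> R^o) /\ continuous Q].

Lemma contractive_functional (Q : V -> R) : linear (Q : V -> R^o) ->
  (forall v, `|Q v| <= `|v|) -> Q \in functional_pred.
Proof.
move=> lQ Q1; apply/mem_set; split=> // v.
have QB u w : Q (u - w) = Q u - Q w.
  by rewrite addrC -scaleN1r lQ scaleN1r addrC.
apply/cvgrPdist_lt => e e0; near=> w.
by rewrite -QB (le_lt_trans (Q1 _)).
Unshelve. all: by end_near. Qed.

Definition dual : Type := {Q : V -> R | Q \in functional_pred}.

Definition dual_fun (Q : dual) : V -> R := val Q.

HB.instance Definition _ := SubChoice.on dual.

Lemma functional_submod : submod_closed functional_pred.
Proof.
split.
  apply/mem_set; split; last by move=> x; exact: cvg_cst.
  by move=> a u v; rewrite /= scaler0 addr0.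
move=> a Q P /set_mem[lQ cQ] /set_mem[lP cP]; apply/mem_set; split.
  move=> b u v; rewrite !fctE lQ lP !scalerDr addrACA.
  by rewrite !scalerA [a * b]mulrC.
by move=> x; apply: cvgD; [apply: cvgZl_tmp; exact: cQ|exact: cP].
Qed.

HB.instance Definition _ :=
  GRing.isSubmodClosed.Build R _ functional_pred functional_submod.
HB.instance Definition _ := [SubChoice_isSubLmodule of dual by <:].

(* The weak-star topology, i.e. pointwise convergence on V. *)
HB.instance Definition _ := Topological.copy dual
  (initial_topology (dual_fun : dual -> {ptws V -> R})).

Definition dual_norm (Q : dual) : R :=
  sup [set `|dual_fun Q v| | v in [set v : V | `|v| <= 1]].

End dual.

Coercion dual_fun : dual >-> Funclass.

(* Upper semicontinuity of the restriction of F to A, for the topology induced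
   on A. *)
Definition usc_on (T : topologicalType) (R : realType) (A : set T)
    (F : T -> R) :=
  forall x, A x -> forall a, F x < a -> \forall y \near within A (nbhs x), F y < a.

Section convex_trace.
Context (R : realType) (K : topologicalType) (cK : compact [set: K]).
Context (Phi : submodClosed (cspace R cK)).
Local Notation Phi_star := (dual (subnormed Phi)).

Definition state_space (one_Phi : ccst cK 1 \in Phi) : set Phi_star :=
  [set Q : Phi_star | dual_norm Q = 1 /\
    Q (exist _ (ccst cK 1) one_Phi : subnormed Phi) = 1].

Definition eval_at (x : K) (phi : subnormed Phi) : R := val phi x.

Lemma eval_at_functional x : eval_at x \in @functional_pred R (subnormed Phi).
Proof.
apply: contractive_functional => [a phi psi|phi].
  by rewrite /eval_at linearP.
exact: (le_supnorm (val phi)).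
Qed.

Definition delta (x : K) : Phi_star := exist _ (eval_at x) (eval_at_functional x).

Lemma delta_state (one_Phi : ccst cK 1 \in Phi) (x : K) :
  state_space one_Phi (delta x).
Proof.
split=> //; apply/le_anti/andP; split.
  by apply: sup_le_ub0 => // _ [phi phi1 <-]; exact: le_trans (le_supnorm _ x) _.
have ub1 : ubound [set `|delta x v| | v in [set v : subnormed Phi | `|v| <= 1]] 1.
  by move=> _ [phi phi1 <-]; exact: le_trans (le_supnorm _ x) _.
apply: (le_sup_ub ub1); exists (exist _ (ccst cK 1) one_Phi).
  by apply: supnorm_le => // y; rewrite normr1.
by rewrite /= normr1.
Qed.

(* F is given on the whole dual, but only its values on the state space
   matter: delta x always lies there (delta_state). *)
Definition usc_convex_trace (one_Phi : ccst cK 1 \in Phi) : set (K -> R) :=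
  [set f | exists F : Phi_star -> R,
    [/\ convex_function (state_space one_Phi) F,
        usc_on (state_space one_Phi) F & f = F \o delta]].

End convex_trace.

(* K -> R has no canonical topology in the library; this alias carries the one
   of the metric rho below. *)
Definition rho_fun (R : realType) (K : Type) : Type := K -> R.

Section rho_metric.
Context (R : realType) (K : Type).
Local Notation RK := (rho_fun R K).
Implicit Types f g h : RK.

Definition rho f g : R :=
  sup (range (fun x => `|f x - g x| / (1 + `|f x - g x|))).

Let phi (t : R) := t / (1 + t).

Let phi_ge0 t : 0 <= t -> 0 <= phi t.
Proof. by move=> t0; rewrite divr_ge0// addr_ge0. Qed.

Let phi_le1 t : 0 <= t -> phi t <= 1.
Proof. by move=> t0; rewrite ler_pdivrMr ?mul1r ?lerDr// ltr_pwDl. Qed.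

Let phi_le s t : 0 <= s -> s <= t -> phi s <= phi t.
Proof.
move=> s0 st; have t0 := le_trans s0 st.
rewrite ler_pdivrMr ?ltr_pwDl// mulrAC ler_pdivlMr ?ltr_pwDl//.
by rewrite !mulrDr !mulr1 [t * s]mulrC lerD2r.
Qed.

Let phiD s t : 0 <= s -> 0 <= t -> phi (s + t) <= phi s + phi t.
Proof.
move=> s0 t0; rewrite /phi mulrDl lerD// ler_wpM2l// lef_pV2 ?posrE;
  by rewrite ?ltr_pwDl ?addr_ge0// lerD2l ?lerDl ?lerDr.
Qed.

Let rho_ub f g : ubound (range (fun x => phi `|f x - g x|)) 1.
Proof. by move=> _ [x _ <-]; exact: phi_le1. Qed.

Let le_rho f g x : phi `|f x - g x| <= rho f g.
Proof. by apply: (le_sup_ub (@rho_ub f g)); exists x. Qed.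

Let rho_ge0 f g : 0 <= rho f g.
Proof.
by apply: (sup_ge0 (@rho_ub f g)) => _ [x _ <-] /=; exact: phi_ge0.
Qed.

Lemma rhoxx f : rho f f = 0.
Proof.
apply/le_anti; rewrite rho_ge0 andbT; apply: sup_le_ub0 => // _ [x _ <-].
by rewrite subrr normr0 mul0r.
Qed.

Lemma rho_positivity f g : rho f g = 0 -> f = g.
Proof.
move=> fg; apply/funext => x; apply/eqP; rewrite -subr_eq0 -normr_le0.
by have := le_rho f g x; rewrite fg /phi ler_pdivrMr ?mul0r.
Qed.

Lemma rho_sym f g : rho f g = rho g f.
Proof.
by rewrite /rho; under [in LHS]eq_fun do rewrite distrC.
Qed.

Lemma rho_triangle g f h : rho f h <= rho f g + rho g h.
Proof.
apply: sup_le_ub0 => [|_ [x _ <-]]; first by rewrite addr_ge0.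
rewrite (le_trans (phi_le _ (ler_distD (g x) _ _)))//.
by rewrite (le_trans (phiD _ _))// lerD.
Qed.

HB.instance Definition _ := Choice.on RK.
HB.instance Definition _ :=
  isMetric.Build R RK rhoxx rho_positivity rho_sym rho_triangle.

End rho_metric.

Definition stable (R : realType) (K : topologicalType) (cK : compact [set: K])
    (Phi : {pred cspace R cK}) (B : set (rho_fun R K)) :=
  forall (phi : cspace R cK) (f : rho_fun R K),
    phi \in Phi -> B f -> B (fun x => phi x + f x).

Definition Kmax (R : realType) (K : Type) (f : K -> R) : set K :=
  [set x | forall y, f y <= f x].

(* Main.v *)
Require Import Defs.
From HB Require Import structures.
From mathcomp Require Import all_boot all_order all_algebra.
From mathcomp Require Import all_classical all_reals all_analysis.
From mathcomp Require Import borel_hierarchy lra.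

Import Order.TTheory GRing.Theory Num.Theory.
Import numFieldNormedType.Exports.

Local Open Scope classical_set_scope.
Local Open Scope ring_scope.

(** Composing with the weak-star continuous map [delta] makes every [f] in [B] a
real-valued upper semicontinuous function on the compact space [K]. Such a
function attains its maximum ([Kmax_nonempty]), and its maximum set cannot jump
out of an open set under a uniformly small perturbation ([Kmax_perturb]).

The second fact gives the G-delta part: the functions near which the maximum
set stays in a ball of radius 1/(n+1) form an open set, and the intersection of
these open sets is exactly [G].

For density, stability of [B] under [Phi] allows [f] to be replaced by
[phi + f] with [phi] in [Phi], so it suffices to find a small [phi] for which
[phi + f] has a single maximum point ([generic_unique_max]). This follows
Mazur's proof that a continuous convex function on a separable Banach space is
generically Gateaux differentiable, applied to the function that sends [phi] to
the maximum of [phi + f]. Fix countably many functions [psi k] in [Phi] such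
that any two distinct points are at least 1 apart under one of them
([separating_sequence]). The set of [phi] for which [psi k] oscillates by less
than 1 over the maximum points of [phi + f] is open, by [Kmax_perturb], and
dense, because a small positive multiple of [psi k] added to [phi] forces all
maximum points to values of [psi k] close to the largest one
([Kmax_add_multiple]). As [Phi] is closed, it is complete
([subspace_complete]), and Baire's theorem provides a small [phi] in all these
sets at once; then no two maximum points of [phi + f] are distinct. *)

(** * Upper semicontinuous functions and their maximum sets *)

Definition usc {R : realType} {T : topologicalType} (f : T -> R) :=
  forall x a, f x < a -> \forall y \near x, f y < a.

Lemma uscD {R : realType} {T : topologicalType} (f g : T -> R) :
  usc f -> usc g -> usc (f \+ g).
Proof.
move=> uf ug x a fga; pose e := (a - (f x + g x)) / 2.
have e0 : 0 < e by rewrite /e /=; move: fga => /=; lra.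
near=> y.
have : f y < f x + e by near: y; apply: uf; lra.
have : g y < g x + e by near: y; apply: ug; lra.
by rewrite /e /=; lra.
Unshelve. all: by end_near. Qed.

Lemma continuous_usc {R : realType} {T : topologicalType} (f : T -> R) :
  continuous f -> usc f.
Proof. by move=> cf x a fa; exact: (cvgr_lt (f x) (cf x)). Qed.

(** If the supremum [S] were not attained, every point would have a
neighborhood on which [f] is below some level less than [S]; compactness makes
one such level work everywhere. The same argument with levels going to infinity
shows that [f] is bounded above. *)
Lemma Kmax_nonempty {R : realType} {T : topologicalType} (f : T -> R) :
  compact [set: T] -> [set: T] !=set0 -> usc f -> Kmax f !=set0.
Proof.
move=> /compact_near_coveringP cT [x0 _] uf.
have [M fM] : exists M, forall x, f x < M.
  have : \forall M \near +oo, [set: T] `<=` [set x | f x < M].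
    apply: (cT _ _ (fun M x => f x < M)) => x _.
    exists ([set y | f y < f x + 1], [set M | f x + 1 <= M]).
      split; first by apply: uf; rewrite ltrDl.
      by apply: nbhs_pinfty_ge; exact: num_real.
    by move=> [y M] /= [+ ?]; move=> /lt_le_trans; exact.
  by move=> /filter_ex[M fM]; exists M => x; exact: fM.
have fS : has_sup (range f).
  by split; [exists (f x0), x0|exists M => _ [x _ <-]; exact/ltW].
apply: contrapT => /set0P/negP; rewrite negbK => /eqP Kf0.
have lt_sup x : f x < sup (range f).
  have fxS : f x <= sup (range f) by apply: ub_le_sup; [case: fS|exists x].
  rewrite lt_neqAle fxS andbT; apply/negP => /eqP fx.
  suff : Kmax f x by rewrite Kf0.
  by move=> y; rewrite fx; apply: ub_le_sup; [case: fS|exists y].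
have : \forall b \near (sup (range f))^'-, [set: T] `<=` [set x | f x < b].
  apply: (cT _ _ (fun b x => f x < b)) => x _.
  have := lt_sup x; set S := sup _ => fxS.
  exists ([set y | f y < (f x + S) / 2], [set b | (f x + S) / 2 < b]).
    by split; [apply: uf; lra|apply: nbhs_left_gt; lra].
  by move=> [y b] /= [+ ?]; move=> /lt_trans; exact.
have : \forall b \near (sup (range f))^'-, b < sup (range f).
  exact: nbhs_left_lt.
move=> /[swap] H1 H2; have [b [fb bS]] := filter_ex (filterI H1 H2).
have : sup (range f) <= b.
  by apply: ge_sup; [case: fS|move=> _ [x _ <-]; exact/ltW/fb].
by rewrite leNgt bS.
Qed.

(** Off [U] every value of [f] is less than the maximum, so by compactness it is
less by a uniform gap; a perturbation by at most half of the gap cannot bring a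
point outside [U] up to the maximum. *)
Lemma Kmax_perturb {R : realType} {T : topologicalType} (f : T -> R)
    (U : set T) : compact [set: T] -> [set: T] !=set0 -> usc f -> open U ->
    Kmax f `<=` U ->
  exists2 e, 0 < e &
    forall g : T -> R, (forall x, `|f x - g x| <= e) -> Kmax g `<=` U.
Proof.
move=> cT T0 uf oU fU; have [z fz] := Kmax_nonempty _ cT T0 uf.
have : \forall e \near (0 : R)^'+,
    [set: T] `<=` [set x | U x \/ f x < f z - e].
  move/compact_near_coveringP : cT => cT.
  apply: (cT _ _ (fun e x => U x \/ f x < f z - e)) => x _.
  have [Ux|nUx] := pselect (U x).
    exists (U, setT); last by move=> [y e] [/=]; left.
    by split; [exact: open_nbhs_nbhs|exact: filterT].
  have fxz : f x < f z.
    rewrite lt_neqAle fz andbT; apply/negP => /eqP fxz.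
    by apply: nUx; apply: fU => y; rewrite fxz.
  exists ([set y | f y < (f x + f z) / 2], [set e | e < (f z - f x) / 2]).
    by split; [apply: uf; lra|apply: nbhs_right_lt; lra].
  by move=> [y e] /= [? ?]; right; lra.
have : \forall e \near (0 : R)^'+, 0 < e by exact: nbhs_right_gt.
move=> /[swap] H1 H2; have [e [He e0]] := filter_ex (filterI H1 H2).
exists (e / 2) => [|g fg x gx]; first lra.
have [//|fx] := He x I.
have := gx z; have := fg x; have := fg z; rewrite !ler_norml.
move=> /andP[? ?] /andP[? ?]; lra.
Qed.

(** * Convex traces and the ambient function spaces *)

Lemma cspace_continuous {R : realType} {K : topologicalType}
  {cK : compact [set: K]} (phi : cspace R cK) : continuous phi.
Proof. exact: (@cts_fun _ _ (phi : continuousType K R)). Qed.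

Lemma trace_usc {R : realType} {K : topologicalType}
    {cK : compact [set: K]} {Phi : submodClosed (cspace R cK)}
    (one_Phi : ccst cK 1 \in Phi) (f : K -> R) :
  usc_convex_trace one_Phi f -> usc f.
Proof.
move=> [F [_ uF ->]] x a /= Fa.
have cd : continuous (@delta R K cK Phi).
  apply: continuous_comp_initial => y.
  apply/pointwise_cvgP => phi; exact: cspace_continuous.
have nearF : \forall y \near x,
    state_space one_Phi (delta Phi y) -> F (delta Phi y) < a.
  exact: (cd x _ (uF _ (delta_state one_Phi x) _ Fa)).
by apply: filterS nearF => y; apply; exact: delta_state.
Qed.

(** The inclusion of [Phi] in C(K). Unlike the generic [val] it has the type of
sup-normed functions as its declared codomain, so that sup-norm lemmas unify
with the norm of [subnormed Phi] without unfolding the subtype structure. *)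
Definition incl {R : realType} {K : topologicalType} {cK : compact [set: K]}
  {Phi : submodClosed (cspace R cK)} (phi : subnormed Phi) : cspace R cK :=
  val phi.

Lemma norm_incl {R : realType} {K : topologicalType}
  {cK : compact [set: K]} {Phi : submodClosed (cspace R cK)}
  (phi : subnormed Phi) : `|phi| = supnorm (incl phi).
Proof. by []. Qed.

Lemma inclB {R : realType} {K : topologicalType}
    {cK : compact [set: K]} {Phi : submodClosed (cspace R cK)}
    (phi psi : subnormed Phi) x : incl (phi - psi) x = incl phi x - incl psi x.
Proof. by []. Qed.

Lemma le_norm_incl {R : realType} {K : topologicalType}
    {cK : compact [set: K]} {Phi : submodClosed (cspace R cK)}
    (phi psi : subnormed Phi) x : `|incl phi x - incl psi x| <= `|phi - psi|.
Proof. by rewrite -inclB norm_incl le_supnorm. Qed.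

Lemma norm_incl_le {R : realType} {K : topologicalType}
    {cK : compact [set: K]} {Phi : submodClosed (cspace R cK)}
    (phi psi : subnormed Phi) (e : R) :
  0 <= e -> (forall x, `|incl phi x - incl psi x| <= e) -> `|phi - psi| <= e.
Proof.
move=> e0 le; rewrite norm_incl.
by apply: supnorm_le => [//|x]; rewrite inclB; exact: le.
Qed.

(** The metric [rho] defines the topology of uniform convergence, since
[t / (1 + t)] is at most [t] and increases with [t]; this lemma and the next one
pass between [rho] and uniform bounds. *)
Lemma rho_le {R : realType} {K : Type} (f g : rho_fun R K) (e : R) :
  0 <= e -> (forall x, `|f x - g x| <= e) -> rho f g <= e.
Proof.
move=> e0 fge; apply: sup_le_ub0 => // _ [x _ <-].
apply: le_trans (fge x); rewrite ler_pdivrMr ?ltr_pwDl//.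
by rewrite ler_peMr// lerDl.
Qed.

Lemma rho_lt {R : realType} {K : Type} (f g : rho_fun R K) (e : R) :
  0 < e -> rho f g < e / (1 + e) -> forall x, `|f x - g x| <= e.
Proof.
move=> e0 fge x; have : `|f x - g x| / (1 + `|f x - g x|) < e / (1 + e).
  apply: le_lt_trans fge.
  apply: (@le_sup_ub _ _ _ 1); last by exists x.
  move=> _ [y _ <-].
  by rewrite ler_pdivrMr ?mul1r ?lerDr// ltr_pwDl.
rewrite ltr_pdivrMr ?ltr_pwDl// mulrAC ltr_pdivlMr; last lra.
by rewrite !mulrDr !mulr1 [e * _]mulrC ltrD2r; exact: ltW.
Qed.

(** A compact metric space has a countable base. For every pair of basic open
sets on which some member of [Phi] differs by at least 1 everywhere, one such
member is kept. Rescaling a function that separates two points makes it take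
values 3 apart there, hence still at least 1 apart on basic neighborhoods. *)
Lemma separating_sequence {R : realType} {K : metricType R}
    {cK : compact [set: K]} {Phi : submodClosed (cspace R cK)} :
    [set: K] !=set0 ->
    (forall x y : K, x != y ->
      exists2 phi : cspace R cK, phi \in Phi & phi x != phi y) ->
  exists2 psi : nat -> cspace R cK, (forall k, psi k \in Phi) &
    forall x y, x != y -> exists k, 1 <= `|psi k x - psi k y|.
Proof.
move=> [x0 _] sep.
pose KP : pseudoPMetricType R := HB.pack K (isPointed.Build K x0).
have [BB cB [oB Bx]] := @compact_second_countable R KP cK.
pose good (U V : set K) (phi : cspace R cK) := phi \in Phi /\
  forall x y, U x -> V y -> 1 <= `|phi x - phi y|.
have cBB : countable (BB `*` BB) by exact: countableX.
have [s sB] : exists s : nat -> set K * set K, BB `*` BB `<=` range s.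
  exact/pcard_surjP.
have /choice[psi psiP] : forall k, exists phi : cspace R cK, phi \in Phi /\
    ((exists phi', good (s k).1 (s k).2 phi') -> good (s k).1 (s k).2 phi).
  move=> k.
  have [[phi gphi]|] := pselect (exists phi, good (s k).1 (s k).2 phi).
    by exists phi; split => //; case: gphi.
  by move=> ng; exists 0; split => //; exact: rpred0.
exists psi => [k|x y xy]; first by case: (psiP k).
have [phi Pphi phixy] := sep _ _ xy.
pose c := 3 / (phi x - phi y).
have cphi : c * phi x - c * phi y = 3.
  by rewrite -mulrBr /c divfK// subr_eq0.
have nearx : \forall z \near x, `|c * phi x - c * phi z| < 1.
  have cc : {for x, continuous (fun z => c * phi z)}.
    by apply: cvgM; [exact: cvg_cst|exact: cspace_continuous].
  by have /cvgrPdist_lt/(_ 1 ltr01) := cc.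
have neary : \forall z \near y, `|c * phi y - c * phi z| < 1.
  have cc : {for y, continuous (fun z => c * phi z)}.
    by apply: cvgM; [exact: cvg_cst|exact: cspace_continuous].
  by have /cvgrPdist_lt/(_ 1 ltr01) := cc.
have [U [BU Ux] UP] := Bx _ _ nearx.
have [V [BV Vy] VP] := Bx _ _ neary.
have [k _ sk] : range s (U, V) by exact: sB.
exists k; have [|_] := (psiP k).2; last by rewrite sk; apply.
exists (c *: phi); rewrite sk; split; first exact: rpredZ.
move=> x' y' /UP Ux' /VP Vy'.
have -> : (c *: phi) x' - (c *: phi) y' = c * phi x' - c * phi y' by [].
move: Ux' Vy'; rewrite /= !ltr_norml => /andP[? ?] /andP[? ?].
rewrite ler_normr; apply/orP; left; lra.
Qed.

(** A Cauchy filter converges uniformly to its pointwise limit, which is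
therefore continuous, and belongs to [Phi] because [Phi] is closed. *)
Lemma subspace_complete {R : realType} {K : topologicalType}
    {cK : compact [set: K]} {Phi : submodClosed (cspace R cK)} :
    closed [set phi : cspace R cK | phi \in Phi] ->
  forall F : set_system (subnormed Phi),
    ProperFilter F -> cauchy F -> cvg F.
Proof.
move=> Phi_closed F PF cF.
have Fex (e : R) : 0 < e ->
    exists phi0 : subnormed Phi, \forall phi \near F, `|phi0 - phi| < e.
  move=> e0; have [phi0 Fphi0] := (cauchyP F).1 cF e e0.
  by exists phi0; apply: filterS Fphi0 => phi; rewrite -ball_normE.
pose ev x (phi : subnormed Phi) : R := incl phi x.
have evP x (phi psi : subnormed Phi) : `|ev x phi - ev x psi| <= `|phi - psi|.
  exact: le_norm_incl.
have cev x : cvg (ev x @ F).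
  apply: cauchy_cvg; apply: cauchy_exP => e e0.
  have [phi0 F0] := Fex e e0; exists (ev x phi0).
  rewrite /= nbhs_filterE /=.
  apply: filterS F0 => phi; apply: le_lt_trans; exact: evP.
pose l x := lim (ev x @ F).
have lP (e : R) : 0 < e ->
    exists phi0 : subnormed Phi, (\forall phi \near F, `|phi0 - phi| < e) /\
    forall x, `|l x - ev x phi0| <= e.
  move=> e0; have [phi0 F0] := Fex _ e0; exists phi0; split => // x.
  have H : `|ev x phi - ev x phi0| @[phi --> F] --> `|l x - ev x phi0|.
    by apply: cvg_norm; apply: cvgB; [exact: cev|exact: cvg_cst].
  rewrite -(cvg_lim (@Rhausdorff R) H); apply: limr_le.
    by apply/cvg_ex; eexists; exact: H.
  apply: filterS F0 => phi.
  rewrite [in X in X -> _]distrC => /ltW; apply: le_trans.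
  exact: evP.
have cl : continuous l.
  move=> x; apply/cvgrPdist_lt => e e0.
  have e3 : 0 < e / 3 by lra.
  have [phi0 [_ lphi0]] := lP _ e3.
  have /cvgrPdist_lt cphi : {for x, continuous (incl phi0)}.
    exact: cspace_continuous.
  apply: filterS (cphi _ e3) => y; have := lphi0 x; have := lphi0 y.
  rewrite !ltr_norml !ler_norml /ev => /andP[? ?] /andP[? ?] /andP[? ?].
  by apply/andP; split; lra.
pose L : cspace R cK := (mkcts cl : continuousType K R).
have LPhi : L \in Phi.
  apply: Phi_closed => N /nbhs_ballP[e /= e0 eN].
  have [|phi0 [_ lphi0]] := lP (e / 2); first lra.
  exists (incl phi0); split; first exact: (valP phi0).
  apply: eN; rewrite -ball_normE /=.
  apply: (@le_lt_trans _ _ (e / 2)); last lra.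
  by apply: supnorm_le; [lra|exact: lphi0].
apply/cvg_ex; exists (exist _ L LPhi : subnormed Phi).
apply/cvgrPdist_lt => e e0.
have [|phi0 [F0 lphi0]] := lP (e / 3); first lra.
have L0 : `|(exist _ L LPhi : subnormed Phi) - phi0| <= e / 3.
  by apply: norm_incl_le; [lra|exact: lphi0].
apply: filterS F0 => phi phi0e.
rewrite (le_lt_trans (ler_distD phi0 _ _))//; lra.
Qed.

(** * Perturbations with a unique maximum point *)

(** Let [c] be the supremum of [psi] over the maximum points of [f]. Adding
[s * psi] with [s] small keeps the maximum points where [psi] is less than
[c + d], by stability of the maximum set. As [s] is positive, no new maximum
point can have a smaller value of [psi] than an old maximum point does, and
some old one has a value greater than [c - d]. *)
Lemma Kmax_add_multiple {R : realType} {T : topologicalType}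
    (f psi : T -> R) (d t : R) :
  compact [set: T] -> [set: T] !=set0 -> usc f -> continuous psi ->
  (exists M, forall x, `|psi x| <= M) -> 0 < d -> 0 < t ->
  exists s c, [/\ 0 < s, s < t &
    Kmax (fun x => s * psi x + f x) `<=` [set x | `|psi x - c| < d]].
Proof.
move=> cT T0 uf cpsi [M psiM] d0 t0.
have [z fz] := Kmax_nonempty _ cT T0 uf.
have supM : has_sup (psi @` Kmax f).
  split; first by exists (psi z), z.
  by exists M => _ [x _ <-]; exact: le_trans (ler_norm _) (psiM x).
pose c := sup (psi @` Kmax f).
have [_ [x0 fx0 <-] psix0] := sup_adherent d0 supM; rewrite -/c in psix0.
have oV : open (psi @^-1` [set r | r < c + d]).
  by apply: open_comp => [x _|]; [exact: cpsi|exact: open_lt].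
have fV : Kmax f `<=` psi @^-1` [set r | r < c + d].
  move=> x fx /=; suff : psi x <= c by lra.
  by apply: ub_le_sup; [case: supM|exists x].
have [e e0 eV] := Kmax_perturb _ _ cT T0 uf oV fV.
have M0 : 0 <= M := le_trans (normr_ge0 _) (psiM z).
(* The second bound makes [s * psi] uniformly at most [e], also if [M = 0]. *)
pose s := Num.min (t / 2) (e / (M + 1)).
have s0 : 0 < s by rewrite lt_min !divr_gt0//; lra.
exists s, c; split => // [|y gy].
  by rewrite gt_min; apply/orP; left; lra.
have psiy : psi y < c + d.
  apply: eV gy => x; rewrite distrC addrK normrM gtr0_norm//.
  apply: (@le_trans _ _ (e / (M + 1) * (M + 1))); last by rewrite divfK//; lra.
  apply: ler_pM => //; [exact: ltW|by rewrite ge_min lexx orbT|].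
  by have := psiM x; lra.
have : psi x0 <= psi y.
  by rewrite -(ler_pM2l s0); have := gy x0; have := fx0 y; lra.
by rewrite /= ltr_norml; lra.
Qed.

(** Mazur's category argument: the category theorem is applied in [Phi] itself,
so that the perturbation it provides again belongs to [Phi]; the bound [d] comes
from intersecting with a ball around 0. *)
Lemma generic_unique_max {R : realType} {K : metricType R}
    {cK : compact [set: K]} {Phi : submodClosed (cspace R cK)} (f : K -> R)
    (d : R) :
    [set: K] !=set0 ->
    closed [set phi : cspace R cK | phi \in Phi] ->
    (forall x y : K, x != y ->
      exists2 phi : cspace R cK, phi \in Phi & phi x != phi y) ->
    usc f -> 0 < d ->
  exists phi : cspace R cK, [/\ phi \in Phi, forall x, `|phi x| <= d &
    exists x, Kmax (fun y => phi y + f y) = [set x]].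
Proof.
move=> K0 Phi_closed sep uf d0.
pose V : completeNormedModType R := HB.pack (subnormed Phi)
  (Uniform_isComplete.Build (subnormed Phi) (subspace_complete Phi_closed)).
have [psi Ppsi sep_psi] := separating_sequence K0 sep.
have uphi (phi : V) : usc (fun x => incl phi x + f x).
  by apply: uscD => //; apply: continuous_usc; exact: cspace_continuous.
pose O k : set V := [set phi : V | exists c,
  Kmax (fun x => incl phi x + f x) `<=` [set x | `|psi k x - c| < 1 / 2]].
have oO k : open (O k).
  rewrite openE => phi [c phic].
  have oU : open [set x | `|psi k x - c| < 1 / 2].
    have cc : continuous (fun x => `|psi k x - c|).
      move=> x; apply: cvg_norm; apply: cvgB; last exact: cvg_cst.
      exact: cspace_continuous.
    apply: (@open_comp _ _ (fun x => `|psi k x - c|) [set r | r < 1 / 2]).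
      by move=> x _; exact: cc.
    exact: open_lt.
  have [e e0 eU] := Kmax_perturb _ _ cK K0 (uphi phi) oU phic.
  apply/nbhs_ballP; exists e => //= phi'; rewrite -ball_normE /= => phi'e.
  exists c; apply: eU => x.
  rewrite opprD addrACA subrr addr0; apply: le_trans (ltW phi'e).
  exact: le_norm_incl.
have dO k : dense (O k).
  move=> W [phi Wphi]; rewrite openE => /(_ _ Wphi)/nbhs_ballP[e /= e0 eW].
  have M0 := supnorm_ge0 (psi k).
  have t0 : 0 < e / (supnorm (psi k) + 1) by rewrite divr_gt0//; lra.
  have d2 : (0 : R) < 1 / 2 by lra.
  have bpsi : exists M, forall x, `|psi k x| <= M.
    by exists (supnorm (psi k)) => x; exact: le_supnorm.
  have [s [c [s0 st sc]]] := Kmax_add_multiple _ _ _ _ cK K0 (uphi phi)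
    (cspace_continuous (psi k)) bpsi d2 t0.
  pose psiV : V := exist _ (psi k) (Ppsi k).
  exists (phi + s *: psiV); split.
    apply: eW; rewrite -ball_normE /= opprD addrA subrr sub0r normrN normrZ.
    rewrite gtr0_norm//.
    have -> : `|psiV| = supnorm (psi k) by [].
    move: st; rewrite ltr_pdivlMr; last lra.
    by apply: le_lt_trans; rewrite ler_pM2l//; lra.
  exists c; congr (Kmax _ `<=` _): sc; apply/funext => x.
  by rewrite addrA [X in X + _ = _]addrC.
have [phi [phid phiO]] : ball (0 : V) d `&` \bigcap_k O k !=set0.
  apply: (Baire (fun k => conj (oO k) (dO k))); last exact: ball_open.
  by exists 0; exact: ballxx.
have [x fx] := Kmax_nonempty _ cK K0 (uphi phi).
exists (incl phi); split; first exact: (valP phi).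
  move=> y; move: phid; rewrite -ball_normE /= sub0r normrN => /ltW.
  by apply: le_trans; rewrite norm_incl le_supnorm.
exists x; apply/seteqP; split=> [y fy|_ ->//] /=.
apply/eqP; apply: contrapT => /negP /sep_psi[k psik].
have [c fc] := phiO k I; have := fc _ fx; have := fc _ fy.
move: psik; rewrite /= ler_normr !ltr_norml.
by move=> /orP[?|?] /andP[? ?] /andP[? ?]; lra.
Qed.

(** * The theorem *)

Theorem theorem37 (R : realType) (K : metricType R)
    (K_neq0 : [set: K] !=set0) (cK : compact [set: K])
    (Phi : submodClosed (cspace R cK))
    (Phi_closed : closed [set phi : cspace R cK | phi \in Phi])
    (Phi_separates : forall x y : K, x != y ->
      exists2 phi : cspace R cK, phi \in Phi & phi x != phi y)
    (Phi_cst : forall c : R, ccst cK c \in Phi)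
    (B : set (rho_fun R K))
    (B_stable : stable Phi B)
    (B_trace : B `<=` usc_convex_trace (Phi_cst 1)) :
  let G : set B := [set f | exists x : K, Kmax (\val f) = [set x]] in
  dense G /\ Gdelta G.
Proof.
move=> G.
have uB (f : B) : usc (\val f : K -> R).
  exact: (trace_usc (Phi_cst 1) _ (B_trace _ (set_valP f))).
split.
  move=> W [f Wf] [A oA AW]; move: Wf; rewrite -AW => Af.
  have /nbhs_ballP[e /= e0 eA] : nbhs (\val f : rho_fun R K) A.
    exact: open_nbhs_nbhs.
  have [|phi [Pphi phie [x phix]]] :=
    generic_unique_max _ (e / 2) K_neq0 Phi_closed Phi_separates (uB f).
    by rewrite divr_gt0.
  have Bg : B (fun x => phi x + \val f x).
    by apply: B_stable => //; exact: set_valP.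
  exists (SigSub (mem_set Bg)); split; last by exists x.
  apply: eA; rewrite ballEmdist /=.
  apply: (@le_lt_trans _ _ (e / 2)); last lra.
  apply: rho_le => [|y]; first lra.
  by rewrite opprD addrCA subrr addr0 normrN phie.
(* Taking interiors makes these sets open; by stability of the maximum set each
   still contains [G]. *)
exists (fun n => interior [set f : B | exists x,
  Kmax (\val f : K -> R) `<=` ball x (n.+1%:R^-1 : R)]).
  by move=> n; exact: open_interior.
apply/seteqP; split=> [f [x fx] n _|f fn].
  have fU : Kmax (\val f : K -> R) `<=` (ball x (n.+1%:R^-1 : R))°.
    rewrite fx => _ ->; apply: nbhsx_ballx; by [].
  have [e e0 eU] := Kmax_perturb _ _ cK K_neq0 (uB f) (@open_interior _ _) fU.
  have e1 : 0 < e / (1 + e) by rewrite divr_gt0//; lra.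
  exists (set_val @^-1` (ball (\val f : rho_fun R K) (e / (1 + e)))°).
  split=> [||g].
  - exists (ball (\val f : rho_fun R K) (e / (1 + e)))° => //.
    exact: open_interior.
  - exact: nbhsx_ballx.
  move=> /interior_subset; rewrite /= ballEmdist => fg; exists x.
  apply: subset_trans (@interior_subset _ _); apply: eU; exact: rho_lt fg.
have [x fx] := Kmax_nonempty _ cK K_neq0 (uB f).
exists x; apply/seteqP; split=> [y fy|_ ->//] /=.
(* Two distinct maximum points do not fit into a ball of radius less than half
   of their distance. *)
apply: contrapT => /eqP; rewrite -mdist_gt0 => yx.
pose n := Num.truncn (mdist y x / 2)^-1.
have [z fz] := interior_subset (fn n I).
have nyx : n.+1%:R^-1 < mdist y x / 2.
  by rewrite invf_plt ?posrE//; [exact: truncnS_gt|lra].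
have := fz _ fx; have := fz _ fy; rewrite !ballEmdist /=.
move=> /lt_trans/(_ nyx) zy /lt_trans/(_ nyx) zx {nyx}.
by have := metric_triangle y z x; rewrite (metric_sym y z); lra.
Qed.
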